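(* Let $n\in\mathbb{N}$, $1\le r<n$, and $W_0\in\mathbb{R}^{n\times n}$ with $\operatorname{Tr}(W_0)\neq 0$; assume the LoRA gradient-descent iterates for $\min_{B\in\mathbb{R}^{n\times r},A\in\mathbb{R}^{r\times n}}\frac12\operatorname{Tr}^2(W_0-BA)$ remain uniformly bounded. Let $X_0\in\mathbb{R}^{r\times n}$ with $\|X_0\|\neq 0$ and $Y_0=\mathbf{0}_{n\times r}$. Let $U$ solve $U'(t)=\operatorname{Tr}(W_0-U(t))I_n$, $U(0)=Y_0X_0$, and let $(Y,X)$ solve $Y'=\operatorname{Tr}(W_0-YX)X^T$, $X'=\operatorname{Tr}(W_0-YX)Y^T$, $Y(0)=Y_0$, $X(0)=X_0$. Then $$\lim_{t\to\infty}\frac{\|Y(t)X(t)-U(t)\|}{\|U(t)\|}=\frac{\sqrt{n\|X_0^TX_0\|^2-\|X_0\|^4}}{\|X_0\|^2}.$$ Moreover, if the entries of $X_0$ are drawn i.i.d. from $\mathcal{N}(0,\sigma^2)$ with $\sigma^2>0$, then $$\mathbb{E}\left[\lim_{t\to\infty}\frac{\|Y(t)X(t)-U(t)\|^2}{\|U(t)\|^2}\right]=\frac{n^2+n-2}{nr+2},\qquad \mathbb{E}\left[\lim_{t\to\infty}\frac{\|Y(t)X(t)-U(t)\|}{\|U(t)\|}\right]\le\sqrt{\frac{n^2+n-2}{nr+2}}.$$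
   Context: $\operatorname{Tr}^2(W):=(\operatorname{Tr}W)^2$; $\|\cdot\|$ is the Frobenius norm. ''LoRA gradient-descent iterates'' are the iterates of fixed-step gradient descent on the factors $B,A$ of $g(B,A)=\frac12\operatorname{Tr}^2(W_0-BA)$; uniform boundedness means their Frobenius norms are bounded independently of step size and iteration. The expectations are over the random initialization $X_0$. *)

(* Defs.v *)
From HB Require Import structures.
From mathcomp Require Import all_boot all_order all_algebra.
From mathcomp Require Import all_classical all_reals all_analysis.
Set Implicit Arguments. Unset Strict Implicit. Unset Printing Implicit Defensive.
Import Order.TTheory GRing.Theory Num.Theory.
Import numFieldNormedType.Exports.
Local Open Scope classical_set_scope.
Local Open Scope ring_scope.

Section Defs.
Variable R : realType.

Definition frob (m p : nat) (M : 'M[R]_(m, p)) : R :=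
  Num.sqrt (\sum_(i < m) \sum_(j < p) M i j ^+ 2).

Definition lora_obj (n r : nat) (W0 : 'M[R]_n) (B : 'M[R]_(n, r)) (A : 'M[R]_(r, n)) : R :=
  2^-1 * (\tr (W0 - B *m A)) ^+ 2.

Definition grad_B (n r : nat) (W0 : 'M[R]_n) (B : 'M[R]_(n, r)) (A : 'M[R]_(r, n))
  : 'M[R]_(n, r) :=
  \matrix_(i, j) (derive1 (fun s : R => lora_obj W0 (B + s *: delta_mx i j) A) 0).
Definition grad_A (n r : nat) (W0 : 'M[R]_n) (B : 'M[R]_(n, r)) (A : 'M[R]_(r, n))
  : 'M[R]_(r, n) :=
  \matrix_(i, j) (derive1 (fun s : R => lora_obj W0 B (A + s *: delta_mx i j)) 0).

Fixpoint lora_gd (n r : nat) (W0 : 'M[R]_n) (eta : R)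
  (B0 : 'M[R]_(n, r)) (A0 : 'M[R]_(r, n)) (k : nat) : 'M[R]_(n, r) * 'M[R]_(r, n) :=
  match k with
  | 0 => (B0, A0)
  | k'.+1 =>
      let BA := lora_gd W0 eta B0 A0 k' in
      (BA.1 - eta *: grad_B W0 BA.1 BA.2, BA.2 - eta *: grad_A W0 BA.1 BA.2)
  end.

Definition lora_gd_bounded (n r : nat) (W0 : 'M[R]_n)
  (B0 : 'M[R]_(n, r)) (A0 : 'M[R]_(r, n)) : Prop :=
  exists eta_bar : R, 0 < eta_bar /\
  exists C : R, forall eta : R, 0 < eta <= eta_bar -> forall k : nat,
    frob (lora_gd W0 eta B0 A0 k).1 <= C /\ frob (lora_gd W0 eta B0 A0 k).2 <= C.

Definition mx_ode_sol (m p : nat) (F : R -> 'M[R]_(m, p)) (M : R -> 'M[R]_(m, p))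
  (M0 : 'M[R]_(m, p)) : Prop :=
  M 0 = M0 /\
  (forall i j, (fun s => M s i j) x @[x --> 0^'+] --> M 0 i j) /\
  (forall t : R, 0 < t -> forall i j,
      derivable (fun s => M s i j) t 1 /\ derive1 (fun s => M s i j) t = F t i j).

(* Expectation of a nonnegative function of k i.i.d. N(0, s^2) variables
   (iterated integrals against the normal law = product measure by Tonelli). *)
Fixpoint gauss_iter (s : R) (k : nat) (f : seq R -> \bar R) : \bar R :=
  match k with
  | 0 => f [::]
  | k'.+1 => (\int[normal_prob 0 s]_x gauss_iter s k' (fun v => f (x :: v)))%E
  end.

Definition mx_of_seq (r n : nat) (v : seq R) : 'M[R]_(r, n) :=
  \matrix_(i, j) nth 0 v (i * n + j).

Definition gauss_mx_expect (r n : nat) (sigma : R) (g : 'M[R]_(r, n) -> R) : \bar R :=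
  gauss_iter sigma (r * n) (fun v => (g (mx_of_seq r n v))%:E).

End Defs.

(* Main.v *)
(** Along the flow of [(Y, X)] the entries of [Y + X^T] and of [X^T - Y] are
    multiplied by [h] and [- h], so [Y X] stays a multiple of [X0^T X0], while [U]
    is scalar; both traces converge to [\tr W0], whence the limit.  Its square is
    [(n ||X0^T X0||^2 - ||X0||^4) / ||X0||^4], a ratio of quartic forms in the
    Gaussian entries.  Writing [1 / N^2] as the integral of [t exp (- t N)] over
    [t > 0], with [N = ||X0||^2], and applying Tonelli makes every monomial factor
    into one-variable Gaussian moments.  By Isserlis' formula the expectation of
    [P / N^2] is then the sum over pairings of [P] times a constant that does not
    depend on the quartic form [P], and [P = N^2] determines that constant. *)
Require Import Defs.
From HB Require Import structures.
From mathcomp Require Import all_boot all_order all_algebra.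
From mathcomp Require Import all_classical all_reals all_analysis.
From mathcomp Require Import measurable_realfun lebesgue_measure ring lra.
Set Implicit Arguments.
Unset Strict Implicit.
Import Order.TTheory GRing.Theory Num.Theory.
Import numFieldNormedType.Exports.
Local Open Scope classical_set_scope.
Local Open Scope ring_scope.

(** * Scalar differential equations on the half-line, right-continuous at the initial time *)

Section Ode.
Context {R : realType}.
Implicit Types (f g : R -> R) (c t : R).

(** The expectation is an iterated integral of a function about which nothing is known at the zero
    matrix and whose inner integrals come with no measurability. Iterated integrals are therefore
    compared pointwise. The zero vector is met only in the innermost integral, when all earlier
    coordinates vanish, and there it is a null point. This works because a ratio of quartic forms
    has degree zero, hence is constant on a punctured line through the origin. Tonelli is applied to
    the whole sum of monomials, whose terms may have either sign; its nonnegativity comes from the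
    Cauchy-Schwarz inequality between the Gram matrix and the identity. For the flows, the obstacle
    is that entries of [X0] may vanish, so proportionality is obtained by contracting with [X0] and
    never by dividing by an entry. *)

Definition ode1 f g : Prop :=
  f x @[x --> 0^'+] --> f 0 /\ forall t, 0 < t -> is_derive t (1 : R) f (g t).

Lemma ode1_within f g t : ode1 f g -> 0 < t -> {within `[0, t], continuous f}.
Proof.
move=> [f0 fd] t0; apply: derivable_oo_LRcontinuous_within; split => //.
- by move=> x; rewrite in_itv/= => /andP[x0 _]; have [] := fd _ x0.
- apply: cvg_at_left_filter; apply: differentiable_continuous.
  by apply/derivable1_diffP; have [] := fd _ t0.
Qed.

Lemma ode1_le f g t : ode1 f g -> (forall s, 0 < s -> g s <= 0) -> 0 <= t ->
  f t <= f 0.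
Proof.
move=> fg g0; rewrite le_eqVlt => /predU1P[<-//|t0].
have [|x] := @MVT _ f g 0 t t0 _ (ode1_within fg t0).
  by move=> x; rewrite in_itv/= => /andP[x0 _]; apply: (fg.2 _ x0).
rewrite in_itv/= => /andP[x0 _] fE; rewrite -subr_le0 fE subr0.
by rewrite mulr_le0_ge0 ?g0// ltW.
Qed.

Lemma ode1_eq f g g' : (forall t, 0 < t -> g t = g' t) -> ode1 f g -> ode1 f g'.
Proof. by move=> gE [f0 fd]; split => // t t0; rewrite -gE//; apply: fd. Qed.

Lemma ode1_cst c : ode1 (fun=> c) (fun=> 0).
Proof. by split=> [|t _]; [exact: cvg_cst|exact: is_derive_cst]. Qed.

Lemma ode1D f f' g g' : ode1 f f' -> ode1 g g' ->
  ode1 (fun t => f t + g t) (fun t => f' t + g' t).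
Proof.
by move=> [f0 fd] [g0 gd]; split=> [|t t0];
  [exact: cvgD|apply: is_deriveD; [exact: fd|exact: gd]].
Qed.

Lemma ode1M f f' g g' : ode1 f f' -> ode1 g g' ->
  ode1 (fun t => f t * g t) (fun t => f' t * g t + f t * g' t).
Proof.
move=> [f0 fd] [g0 gd]; split=> [|t t0]; first exact: cvgM.
have fdt := fd _ t0; have gdt := gd _ t0.
by apply: is_derive_eq; rewrite addrC /GRing.scale/= (mulrC (g t)).
Qed.

Lemma ode1Z c f f' : ode1 f f' -> ode1 (fun t => c * f t) (fun t => c * f' t).
Proof.
move=> ff'; apply: ode1_eq (ode1M (ode1_cst c) ff') => t _.
by rewrite mul0r add0r.
Qed.

Lemma ode1B f f' g g' : ode1 f f' -> ode1 g g' ->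
  ode1 (fun t => f t - g t) (fun t => f' t - g' t).
Proof.
move=> ff' /(ode1Z (-1)) gg'; have := ode1D ff' gg'.
under eq_fun do rewrite mulN1r.
by under [X in ode1 _ X]eq_fun do rewrite mulN1r.
Qed.

Lemma ode1_sum (I : Type) (s : seq I) (f f' : I -> R -> R) :
  (forall i, ode1 (f i) (f' i)) ->
  ode1 (fun t => \sum_(i <- s) f i t) (fun t => \sum_(i <- s) f' i t).
Proof.
move=> ff'; have nilE (h : I -> R -> R) : (fun t => \sum_(i <- [::]) h i t) = fun=> 0.
  by apply/funext => t; rewrite big_nil.
have consE (h : I -> R -> R) i r : (fun t => \sum_(j <- i :: r) h j t) =
    fun t => h i t + \sum_(j <- r) h j t.
  by apply/funext => t; rewrite big_cons.
elim: s => [|i s IH]; first by rewrite !nilE; exact: ode1_cst.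
by rewrite !consE; exact: ode1D.
Qed.

Lemma ode1_expR c : ode1 (fun t => expR (c * t)) (fun t => c * expR (c * t)).
Proof.
split=> [|t _].
  apply: cvg_at_right_filter.
  apply: (cvg_comp (fun t => c * t) expR); last exact: continuous_expR.
  by apply: cvgM; [exact: cvg_cst|exact: cvg_id].
have h : is_derive t (1 : R) (fun t : R => c * t) c.
  by apply: is_derive_eq; rewrite /GRing.scale/= mulr1.
have := is_derive1_comp (is_derive_expR (c * t)) h.
by rewrite mulrC.
Qed.

Lemma ode1_constant f t : ode1 f (fun=> 0) -> 0 <= t -> f t = f 0.
Proof.
move=> f0 t0; apply/eqP; rewrite eq_le; apply/andP; split.
  exact: ode1_le f0 _ t0.
have := ode1_le (ode1Z (-1) f0) _ t0.
by rewrite !mulN1r lerN2; apply => s _ /=; rewrite ?mulN1r ?mulr0 ?oppr0.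
Qed.

(** Gronwall: [v ^+ 2] times [expR (2 * c * t)] is nonincreasing. Bounding [v * d] instead of [d]
    avoids any discussion of the sign of [v] and allows a rate that varies in time, as in the
    factored flow. *)
Lemma ode1_decay v d c : 0 < c -> ode1 v d ->
  (forall t, 0 < t -> v t * d t <= - c * v t ^+ 2) -> v t @[t --> +oo] --> 0.
Proof.
move=> c0 vd vdle.
have vle t : 0 <= t -> `|v t| <= `|v 0| * expR (- (c * t)).
  move=> t0.
  have := @ode1_le _ _ t (ode1M (ode1M vd vd) (ode1_expR (2 * c))).
  rewrite mulr0 expR0 mulr1 => /(_ _ t0) H.
  rewrite -ler_sqr ?nnegrE ?mulr_ge0 ?expR_ge0// exprMn !real_normK ?num_real//.
  rewrite -expRM_natl mulrN expRN ler_pdivlMr ?expR_gt0//.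
  rewrite mulrA !expr2 H// => s s0.
  rewrite -subr_ge0.
  have -> : 0 - ((d s * v s + v s * d s) * expR (2 * c * s) +
      v s * v s * (2 * c * expR (2 * c * s))) =
    2 * expR (2 * c * s) * (- c * v s ^+ 2 - v s * d s) by ring.
  by rewrite mulr_ge0 ?mulr_ge0 ?expR_ge0// subr_ge0 vdle.
apply/cvgr0Pnorm_le => e e0.
have ev : `|v 0| * expR (- (c * t)) @[t --> +oo] --> 0.
  rewrite -[X in _ --> X](mulr0 `|v 0|); apply: cvgM; first exact: cvg_cst.
  have ct : c * t @[t --> +oo] --> +oo by apply: (gt0_cvgMry c0); exact: cvg_id.
  by have := cvg_comp _ _ ct (@cvgr_expR R); exact.
move/cvgr0Pnorm_le : ev => /(_ _ e0) ev.
near=> t.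
have t0 : 0 <= t by near: t; apply: nbhs_pinfty_ge; rewrite num_real.
apply: le_trans (vle _ t0) _; rewrite -[leLHS]ger0_norm ?mulr_ge0 ?expR_ge0//.
by near: t.
Unshelve. all: by end_near.
Qed.

End Ode.

(** * Frobenius norms as traces *)

Section Frobenius.
Context {R : realType}.

Lemma frob_sqr (m p : nat) (M : 'M[R]_(m, p)) :
  frob M ^+ 2 = \sum_i \sum_j M i j ^+ 2.
Proof.
rewrite /frob sqr_sqrtr// sumr_ge0// => i _.
by rewrite sumr_ge0// => j _; rewrite sqr_ge0.
Qed.

Lemma frob_ge0 (m p : nat) (M : 'M[R]_(m, p)) : 0 <= frob M.
Proof. exact: sqrtr_ge0. Qed.

Lemma frob_sqr_gram (m p : nat) (M : 'M[R]_(m, p)) :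
  \tr (M^T *m M) = frob M ^+ 2.
Proof.
rewrite frob_sqr exchange_big; apply: eq_bigr => j _.
by rewrite mxE; apply: eq_bigr => i _; rewrite mxE expr2.
Qed.

Lemma frob_sqr_scalar (n : nat) (u : R) : frob (u%:M : 'M[R]_n) ^+ 2 = n%:R * u ^+ 2.
Proof.
rewrite -frob_sqr_gram tr_scalar_mx -scalar_mxM mxtrace_scalar expr2.
by rewrite mulr_natl.
Qed.

(** Serves twice: for the gap between the two flows, and with [m = n], [u = \tr G] for the
    Cauchy-Schwarz bound. *)
Lemma frob_sqr_diff (n : nat) (G : 'M[R]_n) (m u : R) :
  frob (m *: G - u%:M) ^+ 2 =
  m ^+ 2 * frob G ^+ 2 - 2 * (m * u * \tr G) + n%:R * u ^+ 2.
Proof.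
have trE : (m *: G - u%:M)^T = m *: G^T - u%:M.
  by apply/matrixP => i j; rewrite !mxE eq_sym.
rewrite -!frob_sqr_gram trE mulmxBl !mulmxBr.
rewrite !mul_scalar_mx !mul_mx_scalar -!scalemxAl -!scalemxAr.
rewrite !raddfB/= !linearZ/= mxtrace_tr mxtrace_scalar -(mulr_natl u) /GRing.scale/=; ring.
Qed.

End Frobenius.

(** * Asymptotics of the two gradient flows *)

Section Flows.
Context {R : realType}.

Lemma mx_ode_entry (m p : nat) (F M : R -> 'M[R]_(m, p)) (M0 : 'M[R]_(m, p)) i j :
  mx_ode_sol F M M0 -> ode1 (fun t => M t i j) (fun t => F t i j).
Proof.
move=> [_ [M0c Md]]; split=> [|t t0]; first exact: M0c.
by have [d dE] := Md t t0 i j; split=> //; rewrite -derive1E.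
Qed.

(** The velocity is a multiple of the identity, so each entry minus its share [(i == j)%:R / n%:R]
    of the trace is conserved; the residual [h] obeys [h' = - n h]. *)
Lemma full_flow (n : nat) (W0 : 'M[R]_n) (U : R -> 'M[R]_n) : (0 < n)%N ->
  mx_ode_sol (fun t => \tr (W0 - U t) *: 1%:M) U 0 ->
  exists2 u : R -> R, (forall t, 0 <= t -> U t = (u t)%:M) &
    u t @[t --> +oo] --> \tr W0 / n%:R.
Proof.
move=> n0 Uode; have n0' : n%:R != 0 :> R by rewrite pnatr_eq0 -lt0n.
pose h t := \tr (W0 - U t).
have trU : ode1 (fun t => \tr (U t)) (fun t => h t * n%:R).
  apply: ode1_eq (ode1_sum _ (fun i => mx_ode_entry i i Uode)) => t _.
  under eq_bigr do rewrite !mxE eqxx mulr1.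
  by rewrite sumr_const card_ord /h mulr_natr.
have U0 : U 0 = 0 := Uode.1.
exists (fun t => \tr (U t) / n%:R).
  move=> t t0; apply/matrixP => i j; rewrite mxE.
  suff /ode1_constant/(_ t0) : ode1 (fun t => U t i j - (i == j)%:R / n%:R * \tr (U t)) (fun=> 0).
    rewrite U0 mxtrace0 mulr0 mxE subr0 => /eqP; rewrite subr_eq0 => /eqP ->.
    by case: (i == j); rewrite /= ?mulr1n ?mulr0n ?mul0r// mulrC mul1r.
  apply: ode1_eq (ode1B (mx_ode_entry i j Uode) (ode1Z _ trU)) => s _.
  rewrite !mxE -/(h s) mulrA mulrAC divfK// mulrC subrr//.
have dec : h t @[t --> +oo] --> 0.
  apply: (ode1_decay (c := n%:R) (d := fun t => - (h t * n%:R))).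
  - by rewrite ltr0n.
  - have := ode1B (ode1_cst (\tr W0)) trU.
    under eq_fun do rewrite -raddfB.
    by apply: ode1_eq => t _; rewrite sub0r.
  - by move=> t _; rewrite le_eqVlt; apply/orP; left; apply/eqP; ring.
have -> : (fun t => \tr (U t) / n%:R) = (fun t => (\tr W0 - h t) / n%:R).
  by apply/funext => t; rewrite /h raddfB/= opprB addrCA subrr addr0.
rewrite -[X in X / _]subr0.
by apply: cvgM; [apply: cvgB => //; exact: cvg_cst|exact: cvg_cst].
Qed.

(* Along the flow [Y + X^T] is multiplied by [h] and [X^T - Y] by [- h], so all
   the products of their entries are conserved; both matrices therefore stay
   proportional to [X0^T], and [\sum X^2 + \sum Y^2 >= ||X0||^2]. *)
Lemma factor_flow (n r : nat) (W0 : 'M[R]_n) (X0 : 'M[R]_(r, n))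
  (Y : R -> 'M[R]_(n, r)) (X : R -> 'M[R]_(r, n)) : frob X0 != 0 ->
  mx_ode_sol (fun t => \tr (W0 - Y t *m X t) *: (X t)^T) Y 0 ->
  mx_ode_sol (fun t => \tr (W0 - Y t *m X t) *: (Y t)^T) X X0 ->
  exists2 m : R -> R, (forall t, 0 <= t -> Y t *m X t = m t *: (X0^T *m X0)) &
    m t @[t --> +oo] --> \tr W0 / frob X0 ^+ 2.
Proof.
move=> X0n Yode Xode; set N := frob X0 ^+ 2.
have N0 : 0 < N by rewrite exprn_gt0// lt_neqAle eq_sym X0n frob_ge0.
pose h t := \tr (W0 - Y t *m X t).
pose P i j t := Y t i j + X t j i.
pose Q i j t := X t j i - Y t i j.
have Yd i j : ode1 (fun t => Y t i j) (fun t => h t * X t j i).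
  by apply: ode1_eq (mx_ode_entry i j Yode) => t _; rewrite !mxE.
have Xd i j : ode1 (fun t => X t i j) (fun t => h t * Y t j i).
  by apply: ode1_eq (mx_ode_entry i j Xode) => t _; rewrite !mxE.
have Pd i j : ode1 (P i j) (fun t => h t * P i j t).
  by apply: ode1_eq (ode1D (Yd i j) (Xd j i)) => t _; rewrite /P; ring.
have Qd i j : ode1 (Q i j) (fun t => - (h t * Q i j t)).
  by apply: ode1_eq (ode1B (Xd j i) (Yd i j)) => t _; rewrite /Q; ring.
have PQ i j k l t : 0 <= t -> P i j t * Q k l t = X0 j i * X0 l k.
  move=> t0; rewrite (ode1_constant (f := fun t => P i j t * Q k l t) _ t0).
    by rewrite /P /Q Yode.1 Xode.1 !mxE add0r subr0.
  by apply: ode1_eq (ode1M (Pd i j) (Qd k l)) => s _; ring.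
have NE : N = \sum_i \sum_j X0 j i ^+ 2 by rewrite /N frob_sqr exchange_big.
(* Coefficients of the projections of [P] and [Q] onto [X0^T]. Contracting the conserved products
   with [X0] gives proportionality from [N > 0] alone. *)
pose p t := (\sum_i \sum_j P i j t * X0 j i) / N.
pose q t := (\sum_i \sum_j Q i j t * X0 j i) / N.
have Pq i j t : 0 <= t -> P i j t * q t = X0 j i.
  move=> t0; rewrite /q mulrA mulr_sumr.
  under eq_bigr => k _.
    rewrite mulr_sumr.
    under eq_bigr do rewrite mulrA PQ// -mulrA -expr2.
    rewrite -mulr_sumr; over.
  by rewrite -mulr_sumr -NE mulfK// gt_eqF.
have pQ i j t : 0 <= t -> p t * Q i j t = X0 j i.
  move=> t0; rewrite /p mulrAC mulr_suml.
  under eq_bigr => k _.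
    rewrite mulr_suml.
    under eq_bigr do rewrite mulrAC PQ// mulrAC -expr2.
    rewrite -mulr_suml; over.
  by rewrite -mulr_suml -NE mulrC mulKf// gt_eqF.
have pq t : 0 <= t -> p t * q t = 1.
  move=> t0; rewrite /p mulrAC mulr_suml.
  under eq_bigr => k _.
    rewrite mulr_suml.
    under eq_bigr do rewrite mulrAC Pq// -expr2.
    over.
  by rewrite -NE divff// gt_eqF.
have PE i j t : 0 <= t -> P i j t = p t * X0 j i.
  by move=> t0; rewrite -(Pq i j t t0) mulrCA pq// mulr1.
have QE i j t : 0 <= t -> Q i j t = q t * X0 j i.
  by move=> t0; rewrite -(pQ i j t t0) mulrA (mulrC (q t)) pq// mul1r.
pose m t := (p t ^+ 2 - q t ^+ 2) / 4.
have YE i j t : 0 <= t -> Y t i j = (p t - q t) / 2 * X0 j i.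
  move=> t0; rewrite mulrAC mulrBl -PE// -QE// /P /Q; lra.
have XE i j t : 0 <= t -> X t i j = (p t + q t) / 2 * X0 i j.
  move=> t0; rewrite mulrAC mulrDl -PE// -QE// /P /Q; lra.
(* This is the [m] above, since the trace of [m *: (X0^T *m X0)] is [m * N]; in this form the limit
   only asks that [h] tend to zero. *)
exists (fun t => (\tr W0 - h t) / N).
  move=> t t0.
  have mE : Y t *m X t = m t *: (X0^T *m X0).
    apply/matrixP => i j; rewrite !mxE mulr_sumr; apply: eq_bigr => k _.
    by rewrite YE// XE// !mxE /m; field.
  rewrite {1}mE; congr (_ *: _); rewrite /h raddfB/= mE linearZ/= frob_sqr_gram.
  by rewrite opprB addrCA subrr addr0 mulfK// gt_eqF.
pose S t := \sum_i \sum_j (X t j i ^+ 2 + Y t i j ^+ 2).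
have dec : h t @[t --> +oo] --> 0.
  apply: (ode1_decay (c := N) (d := fun t => - (h t * S t))) => //.
    have trd : ode1 (fun t => \tr (Y t *m X t)) (fun t => h t * S t).
      have -> : (fun t => \tr (Y t *m X t)) =
          fun t => \sum_i \sum_j Y t i j * X t j i.
        by apply/funext => t; apply: eq_bigr => i _; rewrite mxE.
      apply: ode1_eq (ode1_sum _ (fun i => ode1_sum _
        (fun j => ode1M (Yd i j) (Xd j i)))) => t _.
      rewrite mulr_sumr; apply: eq_bigr => i _.
      by rewrite mulr_sumr; apply: eq_bigr => j _; ring.
    have := ode1B (ode1_cst (\tr W0)) trd.
    under eq_fun do rewrite -raddfB.
    by apply: ode1_eq => t _; rewrite sub0r.
  move=> t t0; rewrite -subr_ge0.
  have -> : - N * h t ^+ 2 - h t * - (h t * S t) = h t ^+ 2 * (S t - N) by ring.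
  rewrite mulr_ge0 ?sqr_ge0// subr_ge0 NE /S ler_sum// => i _; rewrite ler_sum// => j _.
  (* At equal indices the conserved product reads [X0^2 = X^2 - Y^2]. *)
  rewrite (expr2 (X0 _ _)) -(PQ _ _ _ _ t (ltW t0)) /P /Q -subr_ge0.
  have -> : X t j i ^+ 2 + Y t i j ^+ 2 - (Y t i j + X t j i) * (X t j i - Y t i j) =
    2 * Y t i j ^+ 2 by ring.
  by rewrite mulr_ge0 ?sqr_ge0.
rewrite -[X in X / _]subr0.
by apply: cvgM; [apply: cvgB => //; exact: cvg_cst|exact: cvg_cst].
Qed.

(** Numerator and denominator are quadratic in [(m, u)], which tends to [(w / N ^+ 2, w / n)] with
    [w = \tr W0] and [N = frob X0]. Thus [w] cancels, and [w != 0] keeps the limit of the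
    denominator nonzero. *)
Lemma flow_gap_cvg (n r : nat) (W0 : 'M[R]_n) (X0 : 'M[R]_(r, n))
  (U : R -> 'M[R]_n) (Y : R -> 'M[R]_(n, r)) (X : R -> 'M[R]_(r, n)) :
  (0 < n)%N -> \tr W0 != 0 -> frob X0 != 0 ->
  mx_ode_sol (fun t => \tr (W0 - U t) *: 1%:M) U 0 ->
  mx_ode_sol (fun t => \tr (W0 - Y t *m X t) *: (X t)^T) Y 0 ->
  mx_ode_sol (fun t => \tr (W0 - Y t *m X t) *: (Y t)^T) X X0 ->
  frob (Y t *m X t - U t) ^+ 2 / frob (U t) ^+ 2 @[t --> +oo] -->
    (n%:R * frob (X0^T *m X0) ^+ 2 - frob X0 ^+ 4) / frob X0 ^+ 4.
Proof.
move=> n0 w0 X00 Uode Yode Xode.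
have [u UE ulim] := full_flow n0 Uode.
have [m YXE mlim] := factor_flow X00 Yode Xode.
have n0' : n%:R != 0 :> R by rewrite pnatr_eq0 -lt0n.
set G := X0^T *m X0 in YXE *; set N := frob X0 in X00 mlim *.
pose f t := (m t ^+ 2 * frob G ^+ 2 - 2 * (m t * u t * N ^+ 2) + n%:R * u t ^+ 2)
  / (n%:R * u t ^+ 2).
suff fl : f t @[t --> +oo] --> (n%:R * frob G ^+ 2 - N ^+ 4) / N ^+ 4.
  apply: cvg_trans fl; apply: near_eq_cvg; near=> t.
  have t0 : 0 <= t by near: t; apply: nbhs_pinfty_ge; rewrite num_real.
  by rewrite /f UE// YXE// frob_sqr_diff frob_sqr_scalar frob_sqr_gram.
set w := \tr W0 in w0 ulim mlim.
have -> : (n%:R * frob G ^+ 2 - N ^+ 4) / N ^+ 4 =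
  ((w / N ^+ 2) ^+ 2 * frob G ^+ 2 - 2 * (w / N ^+ 2 * (w / n%:R) * N ^+ 2) +
   n%:R * (w / n%:R) ^+ 2) / (n%:R * (w / n%:R) ^+ 2).
  by field; rewrite w0 X00 n0'.
have sq (g : R -> R) (l : R) : g t @[t --> +oo] --> l -> g t ^+ 2 @[t --> +oo] --> l ^+ 2.
  by move=> gl; rewrite expr2; under eq_fun do rewrite expr2; exact: cvgM.
have un : n%:R * u t ^+ 2 @[t --> +oo] --> n%:R * (w / n%:R) ^+ 2.
  by apply: cvgM; [exact: cvg_cst|exact: sq].
apply: cvgM; last first.
  by apply: cvgV => //; rewrite mulf_neq0// expf_neq0// mulf_neq0// invr_neq0.
apply: cvgD => //; apply: cvgB; first by apply: cvgM; [exact: sq|exact: cvg_cst].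
apply: cvgM; first exact: cvg_cst.
by apply: cvgM; [exact: cvgM|exact: cvg_cst].
Unshelve. all: by end_near.
Qed.

Lemma flow_gap_sqrt_cvg (n r : nat) (W0 : 'M[R]_n) (X0 : 'M[R]_(r, n))
  (U : R -> 'M[R]_n) (Y : R -> 'M[R]_(n, r)) (X : R -> 'M[R]_(r, n)) :
  (0 < n)%N -> \tr W0 != 0 -> frob X0 != 0 ->
  mx_ode_sol (fun t => \tr (W0 - U t) *: 1%:M) U 0 ->
  mx_ode_sol (fun t => \tr (W0 - Y t *m X t) *: (X t)^T) Y 0 ->
  mx_ode_sol (fun t => \tr (W0 - Y t *m X t) *: (Y t)^T) X X0 ->
  frob (Y t *m X t - U t) / frob (U t) @[t --> +oo] -->
    Num.sqrt ((n%:R * frob (X0^T *m X0) ^+ 2 - frob X0 ^+ 4) / frob X0 ^+ 4).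
Proof.
move=> n0 w0 X00 Uode Yode Xode.
have /(cvg_comp _ _)/(_ (@sqrt_continuous R _)) := flow_gap_cvg n0 w0 X00 Uode Yode Xode.
apply: cvg_trans; apply: near_eq_cvg; near=> t => /=.
by rewrite -expr_div_n sqrtr_sqr ger0_norm// divr_ge0 ?frob_ge0.
Unshelve. all: by end_near.
Qed.

End Flows.

(** * Gaussian monomials: bounds, derivatives, integrability *)

Section GaussianMonomials.
Context {R : realType}.
Local Notation mu := (@lebesgue_measure R).
Implicit Types (a t x s : R) (e : nat).

(** The density agrees almost everywhere with the Radon-Nikodym derivative, because both have the
    same integral over every measurable set. *)
Lemma integral_normal_prob s (f : R -> \bar R) :
  (normal_prob 0 s).-integrable [set: R] f ->
  (\int[normal_prob 0 s]_x f x = \int[mu]_x (f x * (normal_pdf 0 s x)%:E))%E.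
Proof.
move=> intf.
have dom := normal_prob_dominates (0 : R) s.
rewrite -(Radon_Nikodym_change_of_variables dom)//.
have mpdf : measurable_fun [set: R] (EFin \o normal_pdf 0 s).
  by apply/measurable_EFinP; exact: measurable_normal_pdf.
have mf := measurable_int _ intf.
apply: ae_eq_integral => //.
- by apply: emeasurable_funM => //; exact: measurable_int (Radon_Nikodym_integrable _).
- exact: emeasurable_funM.
- apply: ae_eqe_mul2l; apply: integral_ae_eq => //.
    exact: Radon_Nikodym_integrable.
  by move=> A _ mA; rewrite -Radon_Nikodym_integral.
Qed.

(** The share of one coordinate in a monomial times [expR (- (t * N))]. For [a > 0] it is bounded,
    hence integrable against any normal law, and the normal density merely shifts [a]. *)
Definition gauss_mono e a x : R := x ^+ e * expR (- (a * x ^+ 2)).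

Lemma expr_le_expR (y : R) e : 0 <= y -> y ^+ e <= e%:R ^+ e * expR y.
Proof.
move=> y0; case: e => [|e]; first by rewrite !expr0 mul1r -expR0 ler_expR.
have e0 : 0 < e.+1%:R :> R by [].
have -> : expR y = expR (y / e.+1%:R) ^+ e.+1.
  by rewrite -expRM_natl mulrC divfK// gt_eqF.
rewrite -exprMn; apply: lerXn2r.
- by rewrite nnegrE.
- by rewrite nnegrE mulr_ge0 ?expR_ge0.
rewrite mulrC -ler_pdivrMr//; apply: le_trans (expR_ge1Dx _).
by rewrite lerDr.
Qed.

Lemma gauss_mono_le e a x : 0 < a ->
  `|gauss_mono e a x| <= 1 + e%:R ^+ e / a ^+ e.
Proof.
move=> a0; rewrite /gauss_mono normrM (ger0_norm (expR_ge0 _)) normrX.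
have x2 : 0 <= a * x ^+ 2 by rewrite mulr_ge0 ?sqr_ge0 ?ltW.
have xe : `|x| ^+ e <= 1 + (x ^+ 2) ^+ e.
  rewrite -(real_normK (num_real x)) -exprM mulnC exprM.
  set y := `|x| ^+ e; have : 0 <= (y - 1) ^+ 2 by exact: sqr_ge0.
  have : 0 <= y by rewrite exprn_ge0.
  nra.
apply: (le_trans (ler_wpM2r (expR_ge0 _) xe)).
rewrite mulrDl mul1r; apply: lerD.
  by rewrite -expR0 ler_expR oppr_le0.
rewrite expRN ler_pdivrMr ?expR_gt0// mulrAC ler_pdivlMr ?exprn_gt0//.
by rewrite -exprMn (mulrC _ a); exact: expr_le_expR.
Qed.

(** At [e = 0] the default [e.-1 = 0] is harmless, its coefficient being zero. *)
Lemma is_derive_gauss_mono e a x : is_derive x (1 : R) (gauss_mono e a)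
  (e%:R * gauss_mono e.-1 a x - 2 * a * gauss_mono e.+1 a x).
Proof.
have h : is_derive x (1 : R) (fun x : R => - (a * x ^+ 2)) (- (a * (2 * x))).
  by apply: is_derive_eq; rewrite /GRing.scale/=; ring.
have hE := @is_derive1_comp _ expR (fun x => - (a * x ^+ 2)) x _ _ (is_derive_expR _) h.
have hX : is_derive x (1 : R) (fun x : R => x ^+ e) (e%:R * x ^+ e.-1).
  by have := is_deriveX e (is_derive_id x (1 : R)); rewrite exprfctE /GRing.scale/= mulr1.
refine (@is_derive_eq _ _ _ (gauss_mono e a) _ _ _ _ (is_deriveM hX hE) _).
rewrite /GRing.scale/= /gauss_mono /= (exprS x e); ring.
Qed.

Lemma continuous_gauss_mono e a : continuous (gauss_mono e a).
Proof.
move=> x; apply: differentiable_continuous; apply/derivable1_diffP.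
by have [] := is_derive_gauss_mono e a x.
Qed.

Lemma measurable_gauss_mono e a :
  measurable_fun [set: measurableTypeR R] (gauss_mono e a).
Proof. exact: (@continuous_measurable_fun R _ (@continuous_gauss_mono e a)). Qed.

Lemma bounded_gauss_mono e a : 0 < a -> [bounded gauss_mono e a x | x in [set: measurableTypeR R]].
Proof.
move=> a0; exists (1 + e%:R ^+ e / a ^+ e); split; first exact: num_real.
by move=> y /ltW yM x _ /=; apply: le_trans yM; exact: gauss_mono_le.
Qed.

Lemma integrable_gauss_mono s e t : 0 < t ->
  (normal_prob 0 s).-integrable [set: R] (EFin \o gauss_mono e t).
Proof.
move=> t0; apply: measurable_bounded_integrable => //.
- exact: le_lt_trans (probability_le1 (normal_prob 0 s) measurableT) (ltry 1).
- exact: measurable_gauss_mono.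
- exact: bounded_gauss_mono.
Qed.

Lemma gauss_mono_pdf s e t x : s != 0 ->
  gauss_mono e t x * normal_pdf 0 s x =
  normal_peak s * gauss_mono e (t + (2 * s ^+ 2)^-1) x.
Proof.
move=> s0; rewrite normal_pdfE// /normal_fun subr0 /gauss_mono mulrCA -mulrA -expRD.
by congr (_ * (_ * expR _)); rewrite -mulr_natl; field.
Qed.

Lemma integrable_gauss_mono_lebesgue s e t : s != 0 -> 0 < t ->
  mu.-integrable [set: R] (EFin \o gauss_mono e (t + (2 * s ^+ 2)^-1)).
Proof.
move=> s0 t0.
have := integrableMr measurableT (measurable_gauss_mono e t)
  (bounded_gauss_mono e t0) (integrable_normal_pdf 0 s).
move/(integrableZl measurableT (normal_peak s)^-1).
apply: eq_integrable => // x _ /=.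
by rewrite -!EFinM gauss_mono_pdf// mulKf// gt_eqF// normal_peak_gt0.
Qed.

(** Fundamental theorem of calculus on [[-k, k]], then dominated convergence with majorant [|f|]. *)
Lemma Rintegral_derive_eq0 (F f : R -> R) :
  (forall x, is_derive x (1 : R) F (f x)) -> continuous f ->
  mu.-integrable [set: R] (EFin \o f) ->
  F k%:R @[k --> \oo] --> 0 -> F (- k%:R) @[k --> \oo] --> 0 ->
  (\int[mu]_x (f x)%:E = 0)%E.
Proof.
move=> Ff cf intf Fp Fm.
pose fk k : R -> \bar R := (EFin \o f) \_ (`[- k%:R, k%:R] : set R).
have mf : measurable_fun [set: R] (EFin \o f) := measurable_int _ intf.
have lim1 : (\int[mu]_x fk k x)%E @[k --> \oo] --> (\int[mu]_x (f x)%:E)%E.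
  apply: (@dominated_cvg _ _ _ mu setT measurableT fk _ (abse \o (EFin \o f))) => //.
  - move=> k; apply/(measurable_restrictT _ _).1 => //.
    exact: measurable_funTS.
  - move=> x _; apply: cvg_near_cst; near=> k.
    rewrite /fk patchE mem_set//= in_itv/= -ler_norml.
    by near: k; exact: nbhs_infty_ger.
  - exact: integrable_abse.
  - by move=> x k _; rewrite /fk patchE; case: ifP; rewrite //= normr0 lee_fin.
have lim2 : (\int[mu]_x fk k x)%E @[k --> \oo] --> 0%E.
  rewrite -(subee (x := 0%E))//.
  have : ((F k%:R)%:E - (F (- k%:R))%:E)%E @[k --> \oo] --> (0%:E - 0%:E)%E.
    apply: cvg_EFin; first by near=> k.
    by under eq_fun do rewrite -EFinB /=; exact: cvgB.
  apply: cvg_trans; apply: near_eq_cvg; near=> k.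
  have k0 : (0 < k)%N by near: k; exact: nbhs_infty_gt.
  rewrite /fk -integral_mkcond (@continuous_FTC2 _ f F)//.
  - by rewrite -subr_gt0 opprK addr_gt0 ?ltr0n.
  - exact: continuous_subspaceT.
  - split=> [x _||].
    + by have [] := Ff x.
    + apply: cvg_at_right_filter; apply: differentiable_continuous.
      by apply/derivable1_diffP; have [] := Ff (- k%:R).
    + apply: cvg_at_left_filter; apply: differentiable_continuous.
      by apply/derivable1_diffP; have [] := Ff k%:R.
  - by move=> x _; rewrite derive1E; have [_ ->] := Ff x.
exact: cvg_unique lim1 lim2.
Unshelve. all: by end_near.
Qed.


End GaussianMonomials.

(** * Moments of a normal law under an exponential tilt *)

Section GaussianMoments.
Context {R : realType}.
Local Notation mu := (@lebesgue_measure R).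
Implicit Types (a t x s : R) (e : nat).

Definition gauss_moment s e t : R :=
  fine (\int[normal_prob 0 s]_x (gauss_mono e t x)%:E).

Lemma gauss_momentE s e t : 0 < t ->
  (\int[normal_prob 0 s]_x (gauss_mono e t x)%:E = (gauss_moment s e t)%:E)%E.
Proof.
move=> t0; rewrite /gauss_moment fineK//.
exact: integrable_fin_num (integrable_gauss_mono s e t0).
Qed.

Lemma gauss_moment_lebesgue s e t : s != 0 -> 0 < t ->
  (\int[mu]_x (gauss_mono e (t + (2 * s ^+ 2)^-1) x)%:E =
   ((normal_peak s)^-1 * gauss_moment s e t)%:E)%E.
Proof.
move=> s0 t0; have p0 : normal_peak s != 0 by rewrite gt_eqF ?normal_peak_gt0.
rewrite EFinM -gauss_momentE// integral_normal_prob; last exact: integrable_gauss_mono.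
under [in RHS]eq_integral do rewrite -EFinM gauss_mono_pdf// EFinM.
rewrite integralZl//; last exact: integrable_gauss_mono_lebesgue.
by rewrite muleA -EFinM mulVf// mul1e.
Qed.

(** A monomial with one more power is still bounded, so the decay is at least [M / k]. Taking [u] to
    be [1] or [-1] covers both ends of the line. *)
Lemma gauss_mono_cvg0 e a (u : R) : 0 < a -> `|u| = 1 ->
  gauss_mono e a (u * k%:R) @[k --> \oo] --> 0.
Proof.
move=> a0 u1; pose M := 1 + e.+1%:R ^+ e.+1 / a ^+ e.+1.
apply/cvgr0Pnorm_le => eps eps0.
have Me : 0 < M / eps.
  by rewrite divr_gt0// ltr_wpDr// divr_ge0 ?exprn_ge0// ltW.
near=> k.
have k0 : (0 : R) < k%:R by rewrite ltr0n; near: k; exact: nbhs_infty_gt.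
rewrite -(ler_pM2r k0).
have -> : `|gauss_mono e a (u * k%:R)| * k%:R = `|gauss_mono e.+1 a (u * k%:R)|.
  have uk : `|u * k%:R| = k%:R by rewrite normrM u1 mul1r normr_nat.
  have -> : gauss_mono e.+1 a (u * k%:R) = (u * k%:R) * gauss_mono e a (u * k%:R).
    by rewrite /gauss_mono exprS mulrA.
  by rewrite [in RHS]normrM uk mulrC.
apply: le_trans (gauss_mono_le _ _ a0) _; rewrite -/M mulrC -ler_pdivrMr//.
by near: k; exact: nbhs_infty_ger.
Unshelve. all: by end_near.
Qed.

(** Integration by parts: the derivative of [gauss_mono e] has integral zero. At [e = 0] this says
    that the first moment vanishes. *)
Lemma gauss_moment_rec s e t : s != 0 -> 0 < t ->
  2 * (t + (2 * s ^+ 2)^-1) * gauss_moment s e.+1 t =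
  e%:R * gauss_moment s e.-1 t.
Proof.
move=> s0 t0; set a := t + _.
have a0 : 0 < a.
  by rewrite addr_gt0// invr_gt0 mulr_gt0// exprn_even_gt0.
have p0 : normal_peak s != 0 by rewrite gt_eqF ?normal_peak_gt0.
have i1 := integrable_gauss_mono_lebesgue e.-1 s0 t0.
have i2 := integrable_gauss_mono_lebesgue e.+1 s0 t0.
pose f x := e%:R * gauss_mono e.-1 a x - 2 * a * gauss_mono e.+1 a x.
have iz (c : R) (j : nat) : mu.-integrable [set: R] (EFin \o gauss_mono j a) ->
    mu.-integrable [set: R] (fun x => (c * gauss_mono j a x)%:E).
  by move/(integrableZl measurableT c); apply: eq_integrable => // x _ /=.
have : (\int[mu]_x (f x)%:E = 0)%E.
  apply: (Rintegral_derive_eq0 (F := gauss_mono e a)).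
  - exact: is_derive_gauss_mono.
  - move=> x; apply: cvgB; apply: cvgM; try exact: cvg_cst;
      exact: continuous_gauss_mono.
  - exact: (integrableB measurableT (iz _ _ i1) (iz _ _ i2)).
  - have := @gauss_mono_cvg0 e a 1 a0 (normr1 _).
    by under eq_fun do rewrite mul1r.
  - have := @gauss_mono_cvg0 e a (-1) a0 (normrN1 _).
    by under eq_fun do rewrite mulN1r.
rewrite (integralB measurableT (iz _ _ i1) (iz _ _ i2)).
under eq_integral do rewrite EFinM.
rewrite (integralZl measurableT i1) gauss_moment_lebesgue//.
under eq_integral do rewrite EFinM.
rewrite (integralZl measurableT i2) gauss_moment_lebesgue//.
rewrite -!EFinM -EFinB => -[] /eqP; rewrite subr_eq0 => /eqP H.
by apply: (mulfI (invr_neq0 p0)); rewrite mulrCA -H mulrCA.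
Qed.

(** The double factorial [(e - 1)!!] for even [e], zero for odd [e]. *)
Fixpoint std_normal_moment e : nat :=
  match e with 0 => 1 | 1 => 0 | e'.+2 => e'.+1 * std_normal_moment e' end.

(** For [t > 0], the standard deviation of the normal law obtained by tilting with
    [expR (- (t * x ^+ 2))]. *)
Definition gauss_scale s t : R := (2 * (t + (2 * s ^+ 2)^-1)) `^ (- 2^-1).

Lemma gauss_momentP s e t : s != 0 -> 0 < t ->
  gauss_moment s e t =
  gauss_moment s 0 t * (std_normal_moment e)%:R * gauss_scale s t ^+ e.
Proof.
move=> s0 t0; set a := 2 * (t + (2 * s ^+ 2)^-1).
have a0 : 0 < a by rewrite mulr_gt0// addr_gt0// invr_gt0 mulr_gt0// exprn_even_gt0.
have b2 : gauss_scale s t ^+ 2 = a^-1 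
  by rewrite /gauss_scale -powR_mulrn ?powR_ge0// -powRrM mulNr mulVf// powR_inv1 ?ltW.
have recE j : gauss_moment s j.+1 t = a^-1 * (j%:R * gauss_moment s j.-1 t).
  by rewrite -gauss_moment_rec// mulKf// gt_eqF.
(* The recurrence descends by two degrees, so the induction carries two consecutive ones. *)
suff : (gauss_moment s e t = gauss_moment s 0 t * (std_normal_moment e)%:R * gauss_scale s t ^+ e) /\
  (gauss_moment s e.+1 t =
    gauss_moment s 0 t * (std_normal_moment e.+1)%:R * gauss_scale s t ^+ e.+1) by case.
elim: e => [|e [IH1 IH2]].
  by rewrite recE mul0r !mulr0 mul0r expr0 !mulr1.
split => //; rewrite recE /= IH1 natrM -add2n exprD b2.
by rewrite -add1n natrD; ring.
Qed.

Lemma measurable_gauss_scale s : measurable_fun [set: measurableTypeR R] (gauss_scale s).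
Proof.
apply: (measurableT_comp (measurable_powR (- 2^-1))).
by apply: measurable_funM => //; exact: measurable_funD.
Qed.

End GaussianMoments.

(** * Exchanging the radial parameter with the Gaussian coordinates *)

Section GaussianTonelli.
Context {R : realType}.
Local Notation mu := (@lebesgue_measure R).
Implicit Types (a t x s : R) (e : nat).

Lemma measurable_gauss_mono2 e :
  measurable_fun [set: measurableTypeR R * measurableTypeR R]
    (fun z => gauss_mono e z.2 z.1).
Proof.
apply: measurable_funM; first exact: measurable_funX.
apply: (measurableT_comp (@measurable_expR R)); apply: (measurableT_comp (@oppr_measurable R _)).
by apply: measurable_funM => //; exact: measurable_funX.
Qed.

Lemma measurable_gauss_moment0 s :
  measurable_fun [set: measurableTypeR R] (gauss_moment s 0).
Proof.
apply: (measurableT_comp (@fine_measurable R _ measurableT)).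
have mf : measurable_fun [set: measurableTypeR R * measurableTypeR R]
    (fun z => (gauss_mono 0 z.2 z.1)%:E).
  by apply/measurable_EFinP; exact: measurable_gauss_mono2.
apply: (measurable_fun_fubini_tonelli_G (m1 := normal_prob 0 s) _ mf) => z.
by rewrite lee_fin mulr_ge0 ?expR_ge0.
Qed.

Lemma integral_sum_gauss_mono (I : finType) (A : I -> R) (e : I -> nat) s t :
  0 < t ->
  (\int[normal_prob 0 s]_x (\sum_m A m * gauss_mono (e m) t x)%:E =
   (\sum_m A m * gauss_moment s (e m) t)%:E)%E.
Proof.
move=> t0.
have ig m := integrable_gauss_mono s (e m) t0.
under eq_integral do rewrite -sumEFin.
rewrite integral_sum//; last first.
  move=> m; have := integrableZl measurableT (A m) (ig m).
  by apply: eq_integrable => // x _ /=.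
rewrite -sumEFin; apply: eq_bigr => m _.
under eq_integral do rewrite EFinM.
by rewrite (integralZl measurableT (ig m)) [RHS]EFinM -gauss_momentE.
Qed.

(** Supplies the sign that Tonelli requires once some coordinates are replaced by their moments:
    integrating one coordinate at a time preserves nonnegativity of the sum, whatever the signs of
    its terms. *)
Lemma prod_gauss_moment_ge0 (I : finType) s t k :
  0 < t -> forall (A : I -> R) (e : I -> nat -> nat),
  (forall v, size v = k ->
    0 <= \sum_m A m * \prod_(p < k) gauss_mono (e m p) t v`_p) ->
  0 <= \sum_m A m * \prod_(p < k) gauss_moment s (e m p) t.
Proof.
move=> t0; elim: k => [|k IH] A e A0.
  have := A0 [::] erefl.
  by under eq_bigr do rewrite big_ord0; under [in X in _ -> X]eq_bigr do rewrite big_ord0.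
have H x : 0 <= \sum_m A m * gauss_mono (e m 0) t x *
    \prod_(p < k) gauss_moment s (e m p.+1) t.
  apply: (IH _ (fun m p => e m p.+1)) => v vk.
  have := A0 (x :: v); rewrite /= vk => /(_ erefl).
  by under eq_bigr do rewrite big_ord_recl /= mulrA.
have : (0 <= \int[normal_prob 0 s]_x (\sum_m (A m *
    \prod_(p < k) gauss_moment s (e m p.+1) t) * gauss_mono (e m 0) t x)%:E)%E.
  apply: integral_ge0 => x _; rewrite lee_fin.
  by under eq_bigr do rewrite mulrAC; exact: H.
rewrite integral_sum_gauss_mono// lee_fin.
congr (is_true (_ <= _)); apply: eq_bigr => m _.
by rewrite big_ord_recl /= -mulrA (mulrC (\prod_(_ < _) _)).
Qed.

Lemma eq_gauss_iter s k (f g : seq R -> \bar R) :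
  (forall v, size v = k -> f v = g v) -> gauss_iter s k f = gauss_iter s k g.
Proof.
elim: k f g => [|k IH] f g fg; first exact: fg.
by apply: eq_integral => x _; apply: IH => v vk; apply: fg; rewrite /= vk.
Qed.

(* The weights vanish for [t <= 0], where the moments below are junk: the Gaussian
   monomials need not be integrable there. *)
Lemma gauss_iter_integral (I : finType) s k : s != 0 ->
  forall (w : I -> R -> R) (e : I -> nat -> nat),
  (forall m, measurable_fun [set: measurableTypeR R] (w m)) ->
  (forall m t, t <= 0 -> w m t = 0) ->
  (forall t v, 0 < t -> size v = k ->
    0 <= \sum_m w m t * \prod_(p < k) gauss_mono (e m p) t v`_p) ->
  gauss_iter s k (fun v =>
    \int[mu]_t (\sum_m w m t * \prod_(p < k) gauss_mono (e m p) t v`_p)%:E)%E =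
  (\int[mu]_t (\sum_m w m t * \prod_(p < k)
     (gauss_moment s 0 t * (std_normal_moment (e m p))%:R * gauss_scale s t ^+ e m p))%:E)%E.
Proof.
move=> s0; elim: k => [|k IH] w e mw w0 wge0.
  by apply: eq_integral => t _; congr EFin; apply: eq_bigr => m _; rewrite !big_ord0.
pose H e t := gauss_moment s 0 t * (std_normal_moment e)%:R * gauss_scale s t ^+ e.
have mH e' : measurable_fun [set: measurableTypeR R] (H e').
  apply: measurable_funM; last by apply: measurable_funX; exact: measurable_gauss_scale.
  by apply: measurable_funM => //; exact: measurable_gauss_moment0.
(* [z] pairs the first coordinate with [t]: that coordinate is still free, the later ones are
   already replaced by their moments. *)
pose h (z : R * R) := \sum_m w m z.2 * gauss_mono (e m 0) z.2 z.1 *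
    \prod_(p < k) H (e m p.+1) z.2.
have hge0 z : 0 <= h z.
  case: (ltP 0 z.2) => t0; last first.
    by rewrite /h big1// => m _; rewrite w0// !mul0r.
  rewrite /h; under eq_bigr do under eq_bigr do rewrite /H -gauss_momentP//.
  apply: (prod_gauss_moment_ge0 _ t0 (e := fun m p => e m p.+1)) => v vk.
  have := wge0 _ (z.1 :: v) t0; rewrite /= vk => /(_ erefl).
  by under eq_bigr do rewrite big_ord_recl /= mulrA.
have mh : measurable_fun [set: measurableTypeR R * measurableTypeR R] h.
  apply: measurable_sum => m; apply: measurable_funM.
    apply: measurable_funM; last exact: measurable_gauss_mono2.
    by apply: (measurableT_comp (mw m)); exact: measurable_snd.
  apply: measurable_prod => p _.
  by apply: (measurableT_comp (mH _)); exact: measurable_snd.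
transitivity (\int[normal_prob 0 s]_x \int[mu]_t (h (x, t))%:E)%E.
  apply: eq_integral => x _.
  rewrite -(IH (fun m t => w m t * gauss_mono (e m 0) t x) (fun m p => e m p.+1)).
  - apply: eq_gauss_iter => v vk; apply: eq_integral => t _; congr EFin.
    by apply: eq_bigr => m _; rewrite big_ord_recl /= mulrA.
  - move=> m; apply: measurable_funM => //.
    exact: (measurableT_comp (measurable_gauss_mono2 (e m 0)) (pair1_measurable x)).
  - by move=> m t t0; rewrite w0// mul0r.
  - move=> t v t0 vk; have := wge0 t (x :: v) t0; rewrite /= vk => /(_ erefl).
    by under eq_bigr do rewrite big_ord_recl /= mulrA.
rewrite (fubini_tonelli (m1 := normal_prob 0 s) (m2 := mu) (fun z => (h z)%:E))/=; first last.
- by move=> z; rewrite lee_fin.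
- exact/measurable_EFinP.
apply: eq_integral => t _.
case: (ltP 0 t) => t0; last first.
  rewrite big1 => [|m _]; last by rewrite w0// mul0r.
  by apply: integral0_eq => x _; rewrite /h big1// => m _; rewrite w0// !mul0r.
under eq_integral => x _.
  rewrite /h /=.
  under eq_bigr do rewrite mulrAC.
  over.
rewrite (integral_sum_gauss_mono (fun m => w m t * \prod_(p < k) H (e m p.+1) t))//.
congr EFin; apply: eq_bigr => m _.
by rewrite big_ord_recl /= -/(H _ _) gauss_momentP// -/(H _ _) mulrAC mulrA.
Qed.

End GaussianTonelli.

(** * Isserlis' formula in degree four *)

Section Isserlis.
Context {R : realType}.
Local Notation mu := (@lebesgue_measure R).

(** Gaussian integration by parts: the extra factor of index [a] is paired with each of the [f a]
    others. When [f a = 0] the truncated subtraction is harmless, both sides being zero. *)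
Lemma prod_std_normal_momentS k (a : 'I_k) (f : 'I_k -> nat) :
  \prod_p std_normal_moment ((p == a) + f p) =
  (f a * \prod_p std_normal_moment (f p - (p == a)))%N.
Proof.
rewrite (bigD1 a)//= [in RHS](bigD1 a)//= eqxx mulnA; congr muln.
  by rewrite add1n subn1; case: (f a).
by apply: eq_bigr => p /negPf ->; rewrite subn0.
Qed.

(** How many of the three perfect matchings of the four slots join only equal indices. *)
Definition pairings k (q : 'I_k * 'I_k * 'I_k * 'I_k) : nat :=
  let: (a, b, c, d) := q in
  ((a == b) * (c == d) + (a == c) * (b == d) + (a == d) * (b == c))%N.

Definition quad_degree k (q : 'I_k * 'I_k * 'I_k * 'I_k) (p : nat) : nat :=
  let: (a, b, c, d) := q in ((p == a) + ((p == b) + ((p == c) + (p == d))))%N.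

Definition quad_mono k (v : seq R) (q : 'I_k * 'I_k * 'I_k * 'I_k) : R :=
  let: (a, b, c, d) := q in v`_a * v`_b * v`_c * v`_d.

Lemma prod_std_normal_moment2 k (a b : 'I_k) :
  (\prod_(p < k) std_normal_moment ((p == a) + (p == b)))%N = (a == b).
Proof.
rewrite prod_std_normal_momentS; case: eqVneq => [<-|_]; last by rewrite mul0n.
by rewrite mul1n big1// => p _; rewrite subnn.
Qed.

Lemma prod_std_normal_moment_quad k (q : 'I_k * 'I_k * 'I_k * 'I_k) :
  (\prod_(p < k) std_normal_moment (quad_degree q p))%N = pairings q.
Proof.
move: q => [[[a b] c] d]; rewrite /quad_degree /pairings.
rewrite (prod_std_normal_momentS a (fun p => (p == b) + ((p == c) + (p == d)))%N).
have Eb : a = b -> (\prod_(p < k) std_normal_moment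
    ((p == b) + ((p == c) + (p == d)) - (p == a)) = (c == d))%N.
  move=> ->; rewrite -prod_std_normal_moment2; apply: eq_bigr => p _.
  by rewrite addKn.
have Ec : a = c -> (\prod_(p < k) std_normal_moment
    ((p == b) + ((p == c) + (p == d)) - (p == a)) = (b == d))%N.
  move=> ->; rewrite -prod_std_normal_moment2; apply: eq_bigr => p _.
  by rewrite addnCA addKn.
have Ed : a = d -> (\prod_(p < k) std_normal_moment
    ((p == b) + ((p == c) + (p == d)) - (p == a)) = (b == c))%N.
  move=> ->; rewrite -prod_std_normal_moment2; apply: eq_bigr => p _.
  by rewrite addnA addnK.
rewrite !mulnDl addnA; congr (_ + _ + _)%N.
- by case: (eqVneq a b) => [/Eb ->|]; rewrite ?mul0n.
- by case: (eqVneq a c) => [/Ec ->|]; rewrite ?mul0n.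
- by case: (eqVneq a d) => [/Ed ->|]; rewrite ?mul0n.
Qed.

Lemma prod_gauss_mono_quad k (v : seq R) t (q : 'I_k * 'I_k * 'I_k * 'I_k) :
  \prod_(p < k) gauss_mono (quad_degree q p) t v`_p =
  quad_mono v q * expR (- (t * \sum_(p < k) v`_p ^+ 2)).
Proof.
have pick (a : 'I_k) : \prod_(p < k) v`_p ^+ (p == a :> nat) = v`_a.
  rewrite (bigD1 a)//= eqxx expr1 big1 ?mulr1// => p /negPf pa.
  by rewrite (_ : (p == a :> nat) = false).
rewrite /gauss_mono big_split/=; congr (_ * _).
  move: q => [[[a b] c] d]; rewrite /quad_degree /quad_mono.
  under eq_bigr do rewrite !exprD.
  by rewrite !big_split/= !pick !mulrA.
by rewrite -expR_sum; congr expR; rewrite mulr_sumr sumrN.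
Qed.

Lemma sum_quad_degree k (q : 'I_k * 'I_k * 'I_k * 'I_k) :
  (\sum_(p < k) quad_degree q p = 4)%N.
Proof.
have pick (a : 'I_k) : (\sum_(p < k) (p == a :> nat) = 1)%N.
  rewrite (bigD1 a)//= eqxx big1 ?addn0// => p /negPf pa.
  by rewrite (_ : (p == a :> nat) = false).
by move: q => [[[a b] c] d]; rewrite /quad_degree !big_split/= !pick.
Qed.

(** [D] is the expectation of [P] for independent standard normal entries. Tying both to one
    expansion makes linear combinations immediate, with no appeal to uniqueness of coefficients. *)
Definition quartic k (P : seq R -> R) (D : R) : Prop :=
  exists (I : finType) (c : I -> R) (q : I -> 'I_k * 'I_k * 'I_k * 'I_k),
    (forall v, P v = \sum_m c m * quad_mono v (q m)) /\
    D = \sum_m c m * (pairings (q m))%:R.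

Lemma quartic_lin k (P P' : seq R -> R) (D D' x y : R) :
  quartic k P D -> quartic k P' D' ->
  quartic k (fun v => x * P v + y * P' v) (x * D + y * D').
Proof.
move=> [I [c [q [PE DE]]]] [I' [c' [q' [PE' DE']]]].
exists (I + I')%type, (fun m => match m with inl i => x * c i | inr i => y * c' i end),
  (fun m => match m with inl i => q i | inr i => q' i end).
split=> [v|]; rewrite big_sumType/=.
- rewrite PE PE' !mulr_sumr.
  by congr (_ + _); apply: eq_bigr => i _; rewrite mulrA.
- rewrite DE DE' !mulr_sumr.
  by congr (_ + _); apply: eq_bigr => i _; rewrite mulrA.
Qed.

End Isserlis.

(** * The inverse square as an integral of exponentials *)

Section GaussianQuartics.
Context {R : realType}.
Local Notation mu := (@lebesgue_measure R).

Lemma integral_maxr_expR (N : R) : 0 < N ->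
  (\int[mu]_t (Num.max t 0 * expR (- (t * N)))%:E = (N ^- 2)%:E)%E.
Proof.
move=> N0; have N0' : N != 0 by rewrite gt_eqF.
pose f t := t * expR (- (t * N)); pose F t := - ((t / N + N ^- 2) * expR (- (t * N))).
have Fd t : is_derive t (1 : R) F (f t).
  have h : is_derive t (1 : R) (fun t : R => - (t * N)) (- N).
    by apply: is_derive_eq; rewrite /GRing.scale/=; ring.
  have hE := @is_derive1_comp _ expR (fun t => - (t * N)) t _ _ (is_derive_expR _) h.
  have hL : is_derive t (1 : R) (fun t : R => t / N + N ^- 2) N^-1.
    by apply: is_derive_eq; rewrite /GRing.scale/=; ring.
  refine (@is_derive_eq _ _ _ F _ _ _ _ (is_deriveN (is_deriveM hL hE)) _).
  by rewrite /GRing.scale/= /f; field.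
have cf : continuous f.
  move=> t; apply: cvgM; first exact: cvg_id.
  have h : - (x * N) @[x --> t] --> - (t * N).
    by apply: cvgN; apply: cvgM; [exact: cvg_id|exact: cvg_cst].
  exact: (cvg_comp _ _ h (@continuous_expR R _)).
have FV : F t @[t --> +oo] --> 0.
  apply/cvgr0Pnorm_le => e e0.
  have lim : (2 * N ^- 2) * expR (- (N / 2 * t)) @[t --> +oo] --> 0.
    rewrite -[X in _ --> X](mulr0 (2 * N ^- 2)); apply: cvgM; first exact: cvg_cst.
    have ct : N / 2 * t @[t --> +oo] --> +oo.
      by apply: gt0_cvgMry; [rewrite divr_gt0|exact: cvg_id].
    by have := cvg_comp _ _ ct (@cvgr_expR R); exact.
  move/cvgr0Pnorm_le : lim => /(_ _ e0) lim.
  near=> t.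
  have t0 : 0 <= t by near: t; apply: nbhs_pinfty_ge; rewrite num_real.
  have N2 : 0 < N ^- 2 by rewrite invr_gt0 exprn_gt0.
  rewrite /F normrN ger0_norm; last first.
    apply: mulr_ge0; last exact: expR_ge0.
    apply: addr_ge0; last exact: (ltW N2).
    exact: (divr_ge0 t0 (ltW N0)).
  have : 2 * N ^- 2 * expR (- (N / 2 * t)) <= e.
    have P0 : 0 <= 2 * N ^- 2 * expR (- (N / 2 * t)).
      by apply: mulr_ge0; [rewrite mulr_ge0// ltW|exact: expR_ge0].
    by rewrite -(ger0_norm P0); near: t; exact: lim.
  apply: le_trans.
  (* One half of the exponential absorbs the affine factor through [1 + y <= expR y]; the other half
     tends to zero. *)
  have -> : - (t * N) = - (N / 2 * t) - (N / 2 * t) by field.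
  rewrite expRD mulrA ler_wpM2r ?expR_ge0// expRN ler_pdivrMr ?expR_gt0//.
  have -> : t / N + N ^- 2 = 2 * N ^- 2 * (2^-1 + N / 2 * t) by field.
  have P1 : 0 <= 2 * N ^- 2 by apply: mulr_ge0 => //; exact: (ltW N2).
  apply: (ler_wpM2l P1); apply: (le_trans _ (expR_ge1Dx _)); rewrite lerD2r invf_le1//; lra.
have E : (\int[mu]_(t in `[0%R, +oo[) (f t)%:E = 0%:E - (F 0)%:E)%E.
  apply: (@ge0_continuous_FTC2y _ f F 0 0) => //.
  - by move=> x x0; rewrite mulr_ge0 ?expR_ge0.
  - exact: continuous_subspaceT.
  - apply: cvg_at_right_filter; apply: differentiable_continuous.
    by apply/derivable1_diffP; have [] := Fd 0.
  - by move=> x _; rewrite derive1E; have [_ ->] := Fd x.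
transitivity (\int[mu]_(t in `[0%R, +oo[) (f t)%:E)%E; last first.
  by rewrite E -EFinB /F !mul0r !add0r oppr0 expR0 mulr1 opprK.
rewrite [RHS]integral_mkcond; apply: eq_integral => t _.
rewrite patchE; case: ifPn.
  by rewrite inE/= in_itv/= andbT /f => t0; rewrite max_l.
rewrite notin_setE/= in_itv/= andbT => /negP; rewrite -ltNge => t0.
by rewrite max_r ?mul0r// ltW.
Unshelve. all: by end_near.
Qed.

End GaussianQuartics.

(** * Expectations of degree-zero ratios of quartic forms *)

Section GaussianRatios.
Context {R : realType}.
Local Notation mu := (@lebesgue_measure R).

(** Holds without measurability, since the integral is a difference of suprema over simple
    functions; this suits the inner integrals of [gauss_iter]. *)
Lemma le_integral_pointwise d (T : measurableType d)
  (m : {measure set T -> \bar R}) (f g : T -> \bar R) :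
  (forall x, f x <= g x)%E -> (\int[m]_x f x <= \int[m]_x g x)%E.
Proof.
move=> fg; rewrite /integral !patch_setT; apply: leeB; apply: ge_ereal_sup => _ [h hf <-];
  apply: ereal_sup_ubound; exists h => //= x; apply: le_trans (hf x) _.
- by rewrite !funeposE ge_max !le_max fg lexx orbT.
- by rewrite !funenegE ge_max !le_max leeN2 fg lexx orbT.
Qed.

Lemma integral_normal_prob_point s (y : \bar R) (c : R) :
  (\int[normal_prob 0 s]_x (if x == 0%R then y else c%:E) = c%:E)%E.
Proof.
transitivity (\int[normal_prob 0 s]_x (cst c%:E x))%E; last first.
  rewrite integral_cst//; transitivity (c%:E * 1)%E; last exact: mule1.
  by congr (_ * _)%E; exact: (probability_setT (normal_prob 0 s)).
apply: ae_eq_integral => //.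
- apply: measurable_fun_ifT => //; apply: measurable_fun_eqr => //.
- exists [set 0]; split => //.
    have /null_content_dominatesP := normal_prob_dominates 0 s.
    by apply => //; exact: lebesgue_measure_set1.
  move=> x /= nx; apply/eqP/negPn/negP => /negPf x0.
  by apply: nx => _; rewrite x0.
Qed.

Lemma le_gauss_iter s k (f g : seq R -> \bar R) :
  (forall v, size v = k -> f v <= g v)%E ->
  (gauss_iter s k f <= gauss_iter s k g)%E.
Proof.
elim: k f g => [|k IH] f g fg; first exact: fg.
apply: le_integral_pointwise => x; apply: IH => v vk.
by apply: fg; rewrite /= vk.
Qed.

(** A nonzero head leaves every tail covered by the comparison; a zero head recurses, down to one
    coordinate whose zero is a null point. Elsewhere on that last axis [g] equals [c], so replacing
    the unknown values at zero by [+oo] or [-oo] costs nothing. *)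
Lemma le_gauss_iter_nonzero s k (f g : seq R -> \bar R) (c : R) :
  (forall v, size v = k.+1 -> has (fun x => x != 0%R) v -> f v <= g v)%E ->
  (forall x, x != 0 -> g (rcons (nseq k 0) x) = c%:E) ->
  (gauss_iter s k.+1 f <= gauss_iter s k.+1 g)%E.
Proof.
elim: k f g => [|k IH] f g fg gc.
  apply: (@le_trans _ _ c%:E).
    rewrite -[leRHS](integral_normal_prob_point s +oo%E).
    apply: le_integral_pointwise => x; case: ifPn => x0; first exact: leey.
    by rewrite -(gc x x0) /=; apply: fg => //=; rewrite x0.
  rewrite -[leLHS](integral_normal_prob_point s -oo%E).
  apply: le_integral_pointwise => x; case: ifPn => x0; first exact: leNye.
  by rewrite -(gc x x0).
apply: le_integral_pointwise => x; have [->|x0] := eqVneq x 0.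
  apply: (IH (fun v => f (0 :: v)) (fun v => g (0 :: v))) => [v vk hv|y y0]; last exact: gc.
  by apply: fg; rewrite /= ?vk// hv orbT.
by apply: (@le_gauss_iter s k.+1 (fun v => f (x :: v)) (fun v => g (x :: v))) => v vk; apply: fg; rewrite /= ?vk// x0.
Qed.

Lemma eq_gauss_iter_nonzero s k (f g : seq R -> \bar R) (c : R) :
  (forall v, size v = k.+1 -> has (fun x => x != 0) v -> f v = g v) ->
  (forall x, x != 0 -> g (rcons (nseq k 0) x) = c%:E) ->
  gauss_iter s k.+1 f = gauss_iter s k.+1 g.
Proof.
move=> fg gc; apply/eqP; rewrite eq_le; apply/andP; split.
  by apply: le_gauss_iter_nonzero gc => v vk hv; rewrite fg.
apply: (@le_gauss_iter_nonzero _ _ _ _ c) => [v vk hv|x x0]; first by rewrite fg.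
rewrite fg ?gc//; first by rewrite size_rcons size_nseq.
by rewrite has_rcons x0.
Qed.

Definition sq_norm k (v : seq R) : R := \sum_(p < k) v`_p ^+ 2.

Lemma sq_norm_gt0 k v : size v = k -> has (fun x => x != 0) v -> 0 < sq_norm k v.
Proof.
move=> vk /(has_nthP 0)[i iv v0]; rewrite vk in iv.
rewrite /sq_norm (bigD1 (Ordinal iv))//= ltr_pwDl//; first by rewrite exprn_even_gt0.
by rewrite sumr_ge0// => p _; rewrite sqr_ge0.
Qed.

(** The indices [(i, i, j, j)] admit [1 + 2 * (i == j)] pairings. *)
Lemma quartic_sq_norm k : quartic k (fun v => sq_norm k v ^+ 2) (k%:R ^+ 2 + 2 * k%:R).
Proof.
exists ('I_k * 'I_k)%type, (fun=> 1), (fun m => (m.1, m.1, m.2, m.2)); split.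
  move=> v; rewrite /sq_norm expr2 mulr_suml.
  rewrite -(pair_bigA _ (fun i j => 1 * quad_mono v (i, i, j, j)))/=.
  apply: eq_bigr => i _; rewrite mulr_sumr; apply: eq_bigr => j _.
  by rewrite /quad_mono; ring.
rewrite -(pair_bigA _ (fun i j => 1 * (pairings (i, i, j, j))%:R))/=.
rewrite (eq_bigr (fun i : 'I_k => k%:R + 2 :> R)).
  by rewrite sumr_const card_ord -mulr_natl; ring.
move=> i _; rewrite (eq_bigr (fun j => 1 + (i == j)%:R * 2)).
  rewrite big_split/= sumr_const card_ord (bigD1 i)//= eqxx mul1r big1 ?addr0//.
  by move=> j /negPf ji; rewrite eq_sym ji mul0r.
move=> j _; rewrite /pairings !eqxx mul1r muln1 !natrD.
by case: (i == j); rewrite /= ?mul1r ?mul0r ?addr0// -addrA.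
Qed.

Lemma quartic_homog k (P : seq R -> R) D x (u v : seq R) : quartic k P D ->
  (forall p, v`_p = x * u`_p) -> P v = x ^+ 4 * P u.
Proof.
move=> [I [c [q [PE _]]]] vu; rewrite !PE mulr_sumr; apply: eq_bigr => m _.
by case: (q m) => [[[a b] c'] d]; rewrite /quad_mono !vu; ring.
Qed.

(** What is left once Isserlis' formula has extracted [D]. It is an extended real because its
    finiteness is only a consequence of the comparison with a constant ratio. *)
Definition gauss_radial (s : R) k : \bar R :=
  (\int[mu]_t (Num.max t 0 * (gauss_moment s 0 t ^+ k * gauss_scale s t ^+ 4))%:E)%E.

Lemma measurable_maxr0 : measurable_fun [set: measurableTypeR R] (fun t : R => Num.max t 0).
Proof. by apply: measurable_maxr. Qed.

Lemma gauss_moment0_ge0 (s t : R) : 0 <= gauss_moment s 0 t.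
Proof.
by apply: fine_ge0; apply: integral_ge0 => x _; rewrite lee_fin mulr_ge0 ?expR_ge0.
Qed.

(** Degree-zero homogeneity yields the constancy on the last axis demanded by the comparison off the
    zero vector. *)
Lemma quartic_ratio_axis k (P : seq R -> R) D x : quartic k.+1 P D -> x != 0 ->
  P (rcons (nseq k 0) x) / sq_norm k.+1 (rcons (nseq k 0) x) ^+ 2 =
  P (rcons (nseq k 0) 1) / sq_norm k.+1 (rcons (nseq k 0) 1) ^+ 2.
Proof.
move=> Pq x0; set u := rcons _ 1.
have vu p : (rcons (nseq k 0) x)`_p = x * u`_p.
  rewrite /u !nth_rcons size_nseq nth_nseq.
  by case: ltnP => _; [rewrite mulr0|case: eqP => _; rewrite ?mulr1 ?mulr0].
rewrite (quartic_homog Pq vu).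
have -> : sq_norm k.+1 (rcons (nseq k 0) x) = x ^+ 2 * sq_norm k.+1 u.
  by rewrite /sq_norm mulr_sumr; apply: eq_bigr => p _; rewrite vu exprMn.
by rewrite exprMn -exprM invfM mulrACA divff ?mul1r// expf_neq0.
Qed.

Lemma gauss_iter_quartic_radial s k (P : seq R -> R) D : s != 0 ->
  quartic k.+1 P D -> (forall v, size v = k.+1 -> 0 <= P v) -> 0 <= D ->
  gauss_iter s k.+1 (fun v => (P v / sq_norm k.+1 v ^+ 2)%:E) =
  (D%:E * gauss_radial s k.+1)%E.
Proof.
move=> s0 Pq P0 D0; set K := k.+1.
pose g v := (\int[mu]_t (P v * (Num.max t 0 * expR (- (t * sq_norm K v))))%:E)%E.
have gE v : size v = K -> has (fun x => x != 0) v -> g v = (P v / sq_norm K v ^+ 2)%:E.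
  move=> vK hv; rewrite /g; under eq_integral do rewrite EFinM.
  rewrite ge0_integralZl//.
  - by rewrite integral_maxr_expR ?sq_norm_gt0.
  - apply/measurable_EFinP; apply: measurable_funM; first exact: measurable_maxr0.
    apply: (measurableT_comp (@measurable_expR R)).
    apply: (measurableT_comp (@oppr_measurable R _)).
    exact: measurable_funM.
  - by move=> t _; rewrite lee_fin mulr_ge0 ?expR_ge0// le_max lexx orbT.
  - by rewrite lee_fin P0.
pose u := rcons (nseq k (0 : R)) 1.
transitivity (gauss_iter s K g).
  apply: (@eq_gauss_iter_nonzero _ _ _ _ (P u / sq_norm K u ^+ 2)).
    by move=> v vK hv; rewrite gE.
  move=> x x0; rewrite gE.
  - by rewrite (quartic_ratio_axis Pq x0).
  - by rewrite size_rcons size_nseq.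
  - by rewrite has_rcons x0.
have [I [c [q [PE DE]]]] := Pq.
have fE t v : \sum_m (c m * Num.max t 0) *
    \prod_(p < K) gauss_mono (quad_degree (q m) p) t v`_p =
    P v * (Num.max t 0 * expR (- (t * sq_norm K v))).
  rewrite PE mulr_suml; apply: eq_bigr => m _.
  by rewrite prod_gauss_mono_quad /sq_norm; ring.
have := @gauss_iter_integral _ I s K s0 (fun m t => c m * Num.max t 0)
  (fun m => quad_degree (q m)).
rewrite (eq_gauss_iter s (g := g)); last first.
  by move=> v _; apply: eq_integral => t _; rewrite fE.
move=> ->.
- rewrite /gauss_radial -ge0_integralZl//.
  + apply: eq_integral => t _; rewrite -EFinM; congr EFin.
    rewrite DE mulr_suml; apply: eq_bigr => m _.
    rewrite big_split/= big_split/= prodr_const card_ord.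
    (* Every monomial has total degree 4, so the power of the scale is common to all; only the
       pairing count depends on [m]. *)
    rewrite -[\prod_(i < K) gauss_scale s t ^+ _]expr_sum sum_quad_degree.
    by rewrite -natr_prod prod_std_normal_moment_quad; ring.
  + apply/measurable_EFinP; apply: measurable_funM; first exact: measurable_maxr0.
    apply: measurable_funM; first by apply: measurable_funX; exact: measurable_gauss_moment0.
    by apply: measurable_funX; exact: measurable_gauss_scale.
  + move=> t _; rewrite lee_fin; apply: mulr_ge0; first by rewrite le_max lexx orbT.
    by apply: mulr_ge0; rewrite exprn_ge0 ?powR_ge0 ?gauss_moment0_ge0.
- by move=> m; apply: measurable_funM => //; exact: measurable_maxr0.
- by move=> m t t0; rewrite max_r// mulr0.
- move=> t v t0 vK; rewrite fE mulr_ge0 ?P0// mulr_ge0 ?expR_ge0//.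
  by rewrite le_max lexx orbT.
Qed.

Lemma gauss_iter_cst s k (c : R) : gauss_iter s k (fun=> c%:E) = c%:E.
Proof.
elim: k => [//|k IH] /=.
under eq_integral do rewrite IH.
by rewrite -[RHS](integral_normal_prob_point s c%:E); apply: eq_integral => x _; case: ifP.
Qed.

(* The radial integral is common to all quartics, so [sq_norm ^+ 2], whose ratio
   is 1, determines it. *)
Lemma gauss_iter_quartic s k (P : seq R -> R) D : s != 0 ->
  quartic k.+1 P D -> (forall v, size v = k.+1 -> 0 <= P v) -> 0 <= D ->
  gauss_iter s k.+1 (fun v => (P v / sq_norm k.+1 v ^+ 2)%:E) =
  (D / (k.+1%:R ^+ 2 + 2 * k.+1%:R))%:E.
Proof.
move=> s0 Pq P0 D0; rewrite (gauss_iter_quartic_radial s0 Pq P0 D0).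
set C := k.+1%:R ^+ 2 + 2 * k.+1%:R.
have C0 : 0 < C by rewrite addr_gt0 ?exprn_gt0 ?mulr_gt0.
have := gauss_iter_quartic_radial s0 (quartic_sq_norm k.+1)
  (fun v _ => sqr_ge0 _) (ltW C0).
rewrite (@eq_gauss_iter_nonzero s k _ (fun=> 1%:E) 1)//; last first.
  by move=> v vk hv; rewrite divff// expf_neq0// gt_eqF// sq_norm_gt0.
rewrite gauss_iter_cst -/C; case: (gauss_radial s k.+1) => [r| |].
- rewrite -!EFinM => -[E]; congr EFin.
  by rewrite -[in RHS](mulr1 D) E mulrA mulrAC mulfK// gt_eqF.
- by rewrite gt0_muley ?lte_fin.
- by rewrite gt0_muleNy ?lte_fin.
Qed.

Lemma gauss_iter_quartic_eq s k (P : seq R -> R) D (f : seq R -> \bar R) :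
  (0 < k)%N -> s != 0 -> quartic k P D -> (forall v, 0 <= P v) -> 0 <= D ->
  (forall v, size v = k -> has (fun x => x != 0) v ->
    f v = (P v / sq_norm k v ^+ 2)%:E) ->
  gauss_iter s k f = (D / (k%:R ^+ 2 + 2 * k%:R))%:E.
Proof.
case: k => // k _ s0 Pq P0 D0 fP.
rewrite -(gauss_iter_quartic s0 Pq (fun v _ => P0 v) D0).
apply: eq_gauss_iter_nonzero fP _ => x x0.
by rewrite (quartic_ratio_axis Pq x0).
Qed.

Lemma gauss_iter_quartic_le s k (P : seq R -> R) D (f : seq R -> \bar R) :
  (0 < k)%N -> s != 0 -> quartic k P D -> (forall v, 0 <= P v) -> 0 <= D ->
  (forall v, size v = k -> has (fun x => x != 0%R) v ->
    f v <= (P v / sq_norm k v ^+ 2)%:E)%E ->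
  (gauss_iter s k f <= (D / (k%:R ^+ 2 + 2 * k%:R))%:E)%E.
Proof.
case: k => // k _ s0 Pq P0 D0 fP.
rewrite -(gauss_iter_quartic s0 Pq (fun v _ => P0 v) D0).
apply: le_gauss_iter_nonzero fP _ => x x0.
by rewrite (quartic_ratio_axis Pq x0).
Qed.

End GaussianRatios.

(** * The norm of the Gram matrix as a quartic form *)

Section GramQuartic.
Context {R : realType}.
Variables (r n : nat).

Lemma ord_pair_subproof (i : 'I_r) (j : 'I_n) : (i * n + j < r * n)%N.
Proof.
by apply: (@leq_trans (i.+1 * n)); [rewrite mulSn addnC ltn_add2r|rewrite leq_mul2r ltn_ord orbT].
Qed.

Definition ord_pair (i : 'I_r) (j : 'I_n) : 'I_(r * n) := Ordinal (ord_pair_subproof i j).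

Lemma ord_pair_eq i i' j j' : (ord_pair i j == ord_pair i' j') = (i == i') && (j == j').
Proof.
apply/eqP/andP => [[E]|[/eqP -> /eqP ->//]].
have n0 : (0 < n)%N by apply: leq_ltn_trans (ltn_ord j).
split; apply/eqP/val_inj => /=.
  by have /(congr1 (fun m => m %/ n)%N) := E; rewrite !divnMDl// !divn_small// !addn0.
by have /(congr1 (fun m => m %% n)%N) := E; rewrite !modnMDl !modn_small.
Qed.

Lemma sum_ord_pair (f : nat -> R) :
  \sum_(p < r * n) f p = \sum_(i < r) \sum_(j < n) f (i * n + j)%N.
Proof.
have [->|n0] := posnP n.
  by rewrite muln0 big_ord0 big1// => i _; rewrite big_ord0.
rewrite pair_bigA/= (reindex (fun ij => ord_pair ij.1 ij.2))//=.
have lt1 (p : 'I_(r * n)) : (p %/ n < r)%N by rewrite ltn_divLR.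
have lt2 (p : 'I_(r * n)) : (p %% n < n)%N by rewrite ltn_mod.
exists (fun p => (Ordinal (lt1 p), Ordinal (lt2 p))) => [[i j] _|p _] /=.
  congr (_, _); apply: val_inj => /=.
    by rewrite divnMDl// divn_small// addn0.
  by rewrite modnMDl modn_small.
by apply: val_inj => /=; rewrite -divn_eq.
Qed.

Lemma frob_mx_of_seq (v : seq R) : frob (mx_of_seq r n v) ^+ 2 = sq_norm (r * n) v.
Proof.
rewrite frob_sqr /sq_norm (sum_ord_pair (fun p => v`_p ^+ 2)).
by apply: eq_bigr => i _; apply: eq_bigr => j _; rewrite mxE.
Qed.

Lemma frob_mx_of_seq_eq0 (v : seq R) : size v = (r * n)%N ->
  has (fun x => x != 0) v -> frob (mx_of_seq r n v) != 0.
Proof.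
by move=> vk hv; rewrite -sqrf_eq0 frob_mx_of_seq gt_eqF// sq_norm_gt0.
Qed.

Definition gram_sq (v : seq R) : R :=
  frob ((mx_of_seq r n v)^T *m mx_of_seq r n v) ^+ 2.

(** In [X_ij X_ij' X_i'j X_i'j'] the three matchings force [j = j'], or [i = i'], or both, leaving
    [n r^2], [n^2 r] and [n r] choices of indices. *)
Lemma quartic_gram_sq : quartic (r * n) gram_sq
  (n%:R * r%:R ^+ 2 + n%:R ^+ 2 * r%:R + n%:R * r%:R).
Proof.
exists (('I_n * 'I_n) * ('I_r * 'I_r))%type, (fun=> 1), (fun m =>
  (ord_pair m.2.1 m.1.1, ord_pair m.2.1 m.1.2, ord_pair m.2.2 m.1.1, ord_pair m.2.2 m.1.2)).
split=> [v|].
  rewrite /gram_sq frob_sqr pair_bigA/= -(pair_bigA _ (fun a b => 1 * quad_mono v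
    (ord_pair b.1 a.1, ord_pair b.1 a.2, ord_pair b.2 a.1, ord_pair b.2 a.2)))/=.
  apply: eq_bigr => [[j j']] _ /=; rewrite mxE expr2 mulr_suml.
  rewrite -(pair_bigA _ (fun a b => 1 * quad_mono v
    (ord_pair a j, ord_pair a j', ord_pair b j, ord_pair b j')))/=.
  apply: eq_bigr => i _; rewrite mulr_sumr; apply: eq_bigr => i' _.
  by rewrite !mxE /quad_mono /=; ring.
have delta m (i : 'I_m) : \sum_(i' < m) (i == i')%:R = 1 :> R.
  by rewrite (bigD1 i)//= eqxx big1 ?addr0// => i' /negPf ii'; rewrite eq_sym ii'.
rewrite (eq_bigr (fun m : ('I_n * 'I_n) * ('I_r * 'I_r) =>
  (m.1.1 == m.1.2)%:R + (m.2.1 == m.2.2)%:R + (m.1.1 == m.1.2)%:R * (m.2.1 == m.2.2)%:R : R)).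
  have diag m : \sum_(a : 'I_m * 'I_m) (a.1 == a.2)%:R = m%:R :> R.
    rewrite -(pair_bigA _ (fun i i' => (i == i')%:R : R))/=.
    by under eq_bigr do rewrite delta; rewrite sumr_const card_ord.
  rewrite -(pair_bigA _ (fun a b => (a.1 == a.2)%:R + (b.1 == b.2)%:R +
    (a.1 == a.2)%:R * (b.1 == b.2)%:R : R))/=.
  rewrite (eq_bigr (fun a : 'I_n * 'I_n =>
      (a.1 == a.2)%:R * (r%:R ^+ 2 + r%:R) + r%:R : R)) => [|a _].
    rewrite big_split/= -mulr_suml diag sumr_const card_prod card_ord.
    by rewrite -[r%:R *+ _]mulr_natl natrM; ring.
  rewrite !big_split/= -mulr_sumr diag sumr_const card_prod card_ord.
  by rewrite -[(_ == _)%:R *+ _]mulr_natl natrM; ring.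
move=> [[j j'] [i i']] _ /=; rewrite mul1r !ord_pair_eq !eqxx ?andbT ?andTb.
rewrite (eq_sym j' j) -!natrM -!natrD; congr _%:R.
by case: (i == i'); case: (j == j').
Qed.

(** Cauchy-Schwarz for [G] and the identity, read off the nonnegativity of
    [||n G - (\tr G) I||^2]. *)
Lemma gram_sq_ge (v : seq R) : sq_norm (r * n) v ^+ 2 <= n%:R * gram_sq v.
Proof.
have [n0|n0] := posnP n.
  rewrite /sq_norm big1 ?expr0n /= ?n0 ?mul0r// => p _.
  by have := ltn_ord p; rewrite [X in (_ < X)%N](_ : _ = 0%N) ?n0 ?muln0.
set G := (mx_of_seq r n v)^T *m mx_of_seq r n v.
have := sqr_ge0 (frob (n%:R *: G - (\tr G)%:M)).
rewrite frob_sqr_diff => H.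
rewrite -(@ler_pM2l _ n%:R) ?ltr0n// -frob_mx_of_seq -frob_sqr_gram -/G -subr_ge0.
by rewrite /gram_sq -/G; apply: le_trans H _; rewrite le_eqVlt; apply/orP; left; apply/eqP; ring.
Qed.

End GramQuartic.
Unset Implicit Arguments.
Set Strict Implicit.

Theorem theorem2p8 (R : realType) (n r : nat) (W0 : 'M[R]_n) :
  (1 <= r)%N -> (r < n)%N -> \tr W0 != 0 ->
  (* first part: deterministic initialization X0, Y0 = 0 *)
  (forall (X0 : 'M[R]_(r, n)), frob X0 != 0 ->
     lora_gd_bounded W0 (0 : 'M[R]_(n, r)) X0 ->
     forall (U : R -> 'M[R]_n) (Y : R -> 'M[R]_(n, r)) (X : R -> 'M[R]_(r, n)),
     mx_ode_sol (fun t => \tr (W0 - U t) *: (1%:M : 'M[R]_n)) U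
                ((0 : 'M[R]_(n, r)) *m X0) ->
     mx_ode_sol (fun t => \tr (W0 - Y t *m X t) *: (X t)^T) Y (0 : 'M[R]_(n, r)) ->
     mx_ode_sol (fun t => \tr (W0 - Y t *m X t) *: (Y t)^T) X X0 ->
     (frob (Y t *m X t - U t) / frob (U t)) @[t --> +oo] -->
       Num.sqrt (n%:R * frob (X0^T *m X0) ^+ 2 - frob X0 ^+ 4) / frob X0 ^+ 2)
  /\
  (* second part: X0 with i.i.d. N(0, sigma^2) entries; Ys X0, Xs X0 are the
     solutions of the (Y, X) system started at (0, X0) *)
  (forall (sigma : R), 0 < sigma ->
     forall (U : R -> 'M[R]_n)
            (Ys : 'M[R]_(r, n) -> R -> 'M[R]_(n, r))
            (Xs : 'M[R]_(r, n) -> R -> 'M[R]_(r, n)),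
     (forall X0 : 'M[R]_(r, n), frob X0 != 0 ->
        lora_gd_bounded W0 (0 : 'M[R]_(n, r)) X0) ->
     mx_ode_sol (fun t => \tr (W0 - U t) *: (1%:M : 'M[R]_n)) U
                (0 : 'M[R]_n) ->
     (forall X0 : 'M[R]_(r, n), frob X0 != 0 ->
        mx_ode_sol (fun t => \tr (W0 - Ys X0 t *m Xs X0 t) *: (Xs X0 t)^T)
                   (Ys X0) (0 : 'M[R]_(n, r)) /\
        mx_ode_sol (fun t => \tr (W0 - Ys X0 t *m Xs X0 t) *: (Ys X0 t)^T)
                   (Xs X0) X0) ->
     gauss_mx_expect sigma (fun X0 : 'M[R]_(r, n) =>
        lim ((frob (Ys X0 t *m Xs X0 t - U t) ^+ 2 / frob (U t) ^+ 2)
               @[t --> +oo]))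
       = ((n%:R ^+ 2 + n%:R - 2) / (n%:R * r%:R + 2))%:E
     /\
     (gauss_mx_expect sigma (fun X0 : 'M[R]_(r, n) =>
        (lim ((frob (Ys X0 t *m Xs X0 t - U t) / frob (U t)) @[t --> +oo]))%R)
       <= (Num.sqrt ((n%:R ^+ 2 + n%:R - 2) / (n%:R * r%:R + 2)))%:E)%E).
Proof.
move=> r1 rn w0.
have n0 : (0 < n)%N by exact: leq_ltn_trans rn.
split.
  move=> X0 X00 _ U Y X; rewrite mul0mx => Uode Yode Xode.
  suff -> : Num.sqrt (n%:R * frob (X0^T *m X0) ^+ 2 - frob X0 ^+ 4) / frob X0 ^+ 2 =
      Num.sqrt ((n%:R * frob (X0^T *m X0) ^+ 2 - frob X0 ^+ 4) / frob X0 ^+ 4).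
    exact: (flow_gap_sqrt_cvg n0 w0 X00 Uode Yode Xode).
  have -> : frob X0 ^+ 4 = (frob X0 ^+ 2) ^+ 2 by rewrite -exprM.
  rewrite [in RHS]mulrC sqrtrM ?invr_ge0 ?sqr_ge0// sqrtrV ?sqr_ge0//.
  by rewrite sqrtr_sqr ger0_norm ?sqr_ge0// mulrC.
move=> sigma sigma0 U Ys Xs _ Uode XYode.
have rn0 : (0 < r * n)%N by rewrite muln_gt0 r1.
have sigman0 : sigma != 0 by rewrite gt_eqF.
set E := (_ / _ : R); set K := (r * n)%N.
pose C : R := K%:R ^+ 2 + 2 * K%:R.
have n0R : 0 < n%:R :> R by rewrite ltr0n.
have r0R : 0 < r%:R :> R by rewrite ltr0n.
have C0 : 0 < C by rewrite addr_gt0 ?exprn_gt0 ?mulr_gt0// ltr0n.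
have E0 : 0 < E.
  (* [1 <= r < n] forces [n >= 2]; the strict positivity of [E] later permits division by its square
     root. *)
  have n2 : 2 <= n%:R :> R by rewrite ler_nat; exact: leq_ltn_trans rn.
  by apply: divr_gt0; [nra|rewrite addr_gt0// mulr_gt0].
pose P (v : seq R) := n%:R * gram_sq r n v + (-1) * sq_norm K v ^+ 2.
have PE (v : seq R) : P v / sq_norm K v ^+ 2 =
    (n%:R * frob ((mx_of_seq r n v)^T *m mx_of_seq r n v) ^+ 2 -
     frob (mx_of_seq r n v) ^+ 4) / frob (mx_of_seq r n v) ^+ 4.
  rewrite (_ : frob (mx_of_seq r n v) ^+ 4 = (frob (mx_of_seq r n v) ^+ 2) ^+ 2).
    by rewrite frob_mx_of_seq /P mulN1r.
  by rewrite -exprM.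
have P0 v : 0 <= P v by rewrite /P mulN1r subr_ge0 gram_sq_ge.
have Pq : quartic K P (E * C).
  (* The right side is [n r (n^2 + n - 2)] and [C = n r (n r + 2)], so the factor [n r] cancels in
     the ratio. *)
  have -> : E * C = n%:R * (n%:R * r%:R ^+ 2 + n%:R ^+ 2 * r%:R + n%:R * r%:R) + (-1) * C.
    rewrite /E /C /K natrM; field.
    by rewrite gt_eqF// addr_gt0// mulr_gt0.
  exact: quartic_lin (quartic_gram_sq r n) (quartic_sq_norm K).
have EC0 : 0 <= E * C by rewrite ltW// mulr_gt0.
split.
  rewrite /gauss_mx_expect (gauss_iter_quartic_eq rn0 sigman0 Pq P0 EC0).
    by rewrite -/C mulfK// gt_eqF.
  move=> v vK hv; rewrite PE.
  have X0n := frob_mx_of_seq_eq0 vK hv.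
  have [Yode Xode] := XYode _ X0n.
  congr EFin; apply: cvg_lim; first exact: Rhausdorff.
  exact: (flow_gap_cvg n0 w0 X0n Uode Yode Xode).
(* Jensen for the square root: [sqrt y <= (y / c + c) / 2] with equality at the mean [y = c ^+ 2]. *)
set c := Num.sqrt E.
have c0 : 0 < c by rewrite sqrtr_gt0.
have c2 : c ^+ 2 = E by rewrite sqr_sqrtr// ltW.
(* The bound multiplied by [sq_norm ^+ 2] is again a quartic, so the same formula evaluates it; each
   summand contributes [c / 2] to the expectation. *)
pose Q (v : seq R) := (2 * c)^-1 * P v + c / 2 * sq_norm K v ^+ 2.
have Qq : quartic K Q (c * C).
  have -> : c * C = (2 * c)^-1 * (E * C) + c / 2 * C.
    by rewrite -c2; field; rewrite gt_eqF.
  exact: quartic_lin Pq (quartic_sq_norm K).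
have Q0 v : 0 <= Q v.
  by rewrite addr_ge0// mulr_ge0 ?P0 ?sqr_ge0// ?invr_ge0 ?divr_ge0 ?mulr_ge0// ltW.
have -> : c%:E = (c * C / (K%:R ^+ 2 + 2 * K%:R))%:E by rewrite mulfK// gt_eqF.
apply: (gauss_iter_quartic_le rn0 sigman0 Qq Q0); first by rewrite ltW// mulr_gt0.
move=> v vK hv; rewrite lee_fin.
have X0n := frob_mx_of_seq_eq0 vK hv.
have [Yode Xode] := XYode _ X0n.
have -> := cvg_lim (@Rhausdorff R) (flow_gap_sqrt_cvg n0 w0 X0n Uode Yode Xode).
rewrite -PE; set y := P v / sq_norm K v ^+ 2.
have N0 : sq_norm K v != 0 by rewrite gt_eqF// sq_norm_gt0.
have -> : Q v / sq_norm K v ^+ 2 = (2 * c)^-1 * (y + c ^+ 2).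
  by rewrite /Q /y; field; rewrite N0 gt_eqF.
have y0 : 0 <= y by rewrite divr_ge0 ?P0 ?sqr_ge0.
rewrite mulrC ler_pdivlMr ?mulr_gt0// -[in leRHS](sqr_sqrtr y0) -subr_ge0.
have -> : Num.sqrt y ^+ 2 + c ^+ 2 - Num.sqrt y * (2 * c) = (Num.sqrt y - c) ^+ 2 by ring.
exact: sqr_ge0.
Qed.
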